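(* Writing $B_k^{nb}:=B_k^{neobc}$ and $C_k^{nb}:=C_k^{neobc}$: $$S_n=\frac1{36}\begin{cases}(4B^{nb}_{\frac{n+1}{2}}-C^{nb}_{\frac{n+1}{2}}-3)^2 & n\geq1\text{ odd},\\ (20B^{nb}_{\frac{n+2}{2}}-7C^{nb}_{\frac{n+2}{2}}-15)^2 & n\geq2\text{ even},\end{cases}$$ $$s_n=\frac16\begin{cases}4B^{nb}_{\frac{n+1}{2}}-C^{nb}_{\frac{n+1}{2}}-3 & n\geq1\text{ odd},\\ 20B^{nb}_{\frac{n+2}{2}}-7C^{nb}_{\frac{n+2}{2}}-15 & n\geq2\text{ even},\end{cases}$$ $$t_n=\frac1{12}\begin{cases}-8B^{nb}_{\frac{n+1}{2}}+4C^{nb}_{\frac{n+1}{2}} & n\geq1\text{ odd},\\ 60B^{nb}_{\frac{n+2}{2}}-4B^{nb}_{\frac{n}{2}}-21C^{nb}_{\frac{n+2}{2}}+C^{nb}_{\frac{n}{2}}-48 & n\geq2\text{ even}.\end{cases}$$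
   Context: Let $\alpha=1+\sqrt2$, $\beta=1-\sqrt2$. For $k\ge1$: $S_k=\frac{\alpha^{4k}+\beta^{4k}-2}{32}$ is the $k$-th square triangular number, $S_k=s_k^2=\frac{t_k(t_k+1)}{2}$ with $s_k=\frac{\alpha^{2k}-\beta^{2k}}{4\sqrt2}$ and $t_k=\frac{\alpha^{2k}+\beta^{2k}-2}{4}$. A positive integer $m$ is a neo balcobalancing number if there is a positive integer $r$ such that $(1+2+\cdots+(m-1))+(1+2+\cdots+m)=2[(m-1)+m+(m+1)+(m+2)+\cdots+(m+r)]$ (equivalently, $8m^2-12m+9$ is a perfect square). $B_k^{neobc}$ is the $k$-th neo balcobalancing number in increasing order ($k\ge1$) and $C_k^{neobc}=\sqrt{8(B_k^{neobc})^2-12B_k^{neobc}+9}$. *)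

(* Defs.v *)
From mathcomp Require Import all_boot all_order all_algebra.
From mathcomp Require Import zify.

Set Implicit Arguments.
Unset Strict Implicit.
Unset Printing Implicit Defensive.

Import Order.TTheory GRing.Theory Num.Theory.

Definition neobc_eq (m r : nat) : Prop :=
  \sum_(1 <= i < m) i + \sum_(1 <= i < m.+1) i
    = 2 * \sum_(m.-1 <= i < (m + r).+1) i.

Definition neobc (m : nat) : Prop :=
  0 < m /\ exists r : nat, 0 < r /\ neobc_eq m r.

(* The bound on r is harmless, see neobcP. *)
Definition neobcb (m : nat) : bool :=
  (0 < m) && [exists r : 'I_(m ^ 2).+1, (0 < r) &&
    (\sum_(1 <= i < m) i + \sum_(1 <= i < m.+1) i
      == 2 * \sum_(m.-1 <= i < (m + r).+1) i)].

Lemma neobc_sum_lo m : 0 < m ->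
  \sum_(1 <= i < m) i + \sum_(1 <= i < m.+1) i = m ^ 2.
Proof.
case: m => // m _; elim: m => [|m IHm]; first by rewrite big_geq // big_nat1.
rewrite big_nat_recr // [\sum_(1 <= i < m.+3) i]big_nat_recr //=; lia.
Qed.

Lemma neobc_sum_hi m r : 0 < m ->
  2 * \sum_(m.-1 <= i < (m + r).+1) i = (r + 2) * (2 * m + r - 1).
Proof.
case: m => // m _ /=; elim: r => [|r IHr].
  by rewrite addn0 big_nat_recr //= big_nat1; lia.
rewrite addnS big_nat_recr /=; last by lia.
rewrite mulnDr IHr; nia.
Qed.

Lemma neobc_eqE m r : 0 < m ->
  neobc_eq m r <-> m ^ 2 = (r + 2) * (2 * m + r - 1).
Proof. by move=> m0; rewrite /neobc_eq neobc_sum_lo // neobc_sum_hi. Qed.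

Lemma neobcP m : reflect (neobc m) (neobcb m).
Proof.
apply: (iffP andP) => [[m0 /existsP[r /andP[r0 /eqP e]]]|[m0 [r [r0 e]]]].
  by split=> //; exists (nat_of_ord r).
split=> //; have lt_r : r < (m ^ 2).+1 by move/(neobc_eqE _ m0): e; nia.
by apply/existsP; exists (Ordinal lt_r); rewrite r0; apply/eqP.
Qed.

Lemma neobc_unbounded n : exists m, neobcb m && (n < m).
Proof.
suff [m [r [nm r0 e]]] : exists m r,
    [/\ n < m, 0 < r & m ^ 2 = (r + 2) * (2 * m + r - 1)].
  exists m; rewrite nm andbT; apply/neobcP; split; first by lia.
  by exists r; split=> //; apply/neobc_eqE => //; lia.
elim: n => [|n [m [r [nm r0 e]]]]; first by exists 6, 1.
exists (29 * m + 12 * r - 6), (12 * m + 5 * r - 4); split; [lia|lia|].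
case: m r nm r0 e => [|m] [|r] // nm _ e.
have -> : 29 * m.+1 + 12 * r.+1 - 6 = 29 * m + 12 * r + 35 by lia.
have -> : 12 * m.+1 + 5 * r.+1 - 4 = 12 * m + 5 * r + 13 by lia.
have -> : 2 * (29 * m + 12 * r + 35) + (12 * m + 5 * r + 13) - 1
          = 70 * m + 29 * r + 82 by lia.
have {}e : m.+1 ^ 2 = (r + 3) * (2 * m + r + 2) by rewrite e; congr (_ * _); lia.
nia.
Qed.

(* neobc_nth k is the k-th neo balcobalancing number for k >= 1:
   neobc_nth 1 is the least one and neobc_nth k.+1 the least one exceeding
   neobc_nth k.  The value 0 at k = 0 only seeds the recursion. *)
Fixpoint neobc_nth (k : nat) : nat :=
  if k is k'.+1 then ex_minn (neobc_unbounded (neobc_nth k')) else 0.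

Local Open Scope ring_scope.

Definition Bnb (R : rcfType) (k : nat) : R := (neobc_nth k)%:R.

Definition Cnb (R : rcfType) (k : nat) : R :=
  Num.sqrt (8 * Bnb R k ^+ 2 - 12 * Bnb R k + 9).

Definition alpha (R : rcfType) : R := 1 + Num.sqrt 2.
Definition beta (R : rcfType) : R := 1 - Num.sqrt 2.

(* sqtri, sqtri_side and sqtri_index are S_k, s_k and t_k, given by their
   Binet formulas; S_k = s_k ^ 2 = t_k (t_k + 1) / 2. *)
Definition sqtri (R : rcfType) (k : nat) : R :=
  (alpha R ^+ (4 * k) + beta R ^+ (4 * k) - 2) / 32.

Definition sqtri_side (R : rcfType) (k : nat) : R :=
  (alpha R ^+ (2 * k) - beta R ^+ (2 * k)) / (4 * Num.sqrt 2).

Definition sqtri_index (R : rcfType) (k : nat) : R :=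
  (alpha R ^+ (2 * k) + beta R ^+ (2 * k) - 2) / 4.

(* Main.v *)
(** With [u = m - r - 2] the defining equation [m ^ 2 = (r + 2) (2 m + r - 1)]
    becomes [u ^ 2 = (r + 2) (2 r + 1)].  Reducing modulo 3 forces [u = 3 s] and
    [2 r + 1 = 3 t], which leaves [2 s ^ 2 = t (t + 1)]: the neo balcobalancing
    numbers are the [3 (2 s + t + 1) / 2] for the square triangular pairs
    [(s, t)] with [t] odd.  Descent shows that all pairs are the [(s_n, t_n)],
    and [t_n] has the parity of [n], so that [B_(k+1)] and [C_(k+1)] are affine
    functions of [s_(2k+1)] and [t_(2k+1)]. *)
Require Import Defs.
From mathcomp Require Import all_boot all_order all_algebra.
From mathcomp Require Import zify ring lra.

Set Implicit Arguments.
Unset Strict Implicit.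
Unset Printing Implicit Defensive.

Import Order.TTheory GRing.Theory Num.Theory.

(* In terms of [(2 t + 1) + 2 s sqrt 2] this is multiplication by
   [(1 + sqrt 2) ^ 2]. *)
Definition sqtri_step (p : nat * nat) : nat * nat :=
  (3 * p.1 + 2 * p.2 + 1, 4 * p.1 + 3 * p.2 + 1).

Definition sqtri_root (n : nat) : nat := (iter n sqtri_step (0, 0)).1.
Definition sqtri_rank (n : nat) : nat := (iter n sqtri_step (0, 0)).2.

Lemma sqtri_rootS n :
  sqtri_root n.+1 = 3 * sqtri_root n + 2 * sqtri_rank n + 1.
Proof. by []. Qed.

Lemma sqtri_rankS n :
  sqtri_rank n.+1 = 4 * sqtri_root n + 3 * sqtri_rank n + 1.
Proof. by []. Qed.

Lemma sqtri_root_rank n :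
  2 * sqtri_root n ^ 2 = sqtri_rank n * (sqtri_rank n).+1.
Proof. by elim: n => // n IHn; rewrite sqtri_rootS sqtri_rankS; nia. Qed.

Lemma sqtri_step_preim s t : 0 < s -> 2 * s ^ 2 = t * t.+1 ->
  exists s' t',
    [/\ s' < s, 2 * s' ^ 2 = t' * t'.+1 & sqtri_step (s', t') = (s, t)].
Proof.
move=> s_gt0 st.
have root_le : 2 * t + 1 <= 3 * s by nia.
have rank_le : 4 * s <= 3 * t + 1 by nia.
have s_le_t : s <= t by nia.
have [s' es'] : exists s', 3 * s = s' + 2 * t + 1.
  by exists (3 * s - (2 * t + 1)); lia.
have [t' et'] : exists t', 3 * t + 1 = t' + 4 * s.
  by exists (3 * t + 1 - 4 * s); lia.
have es : s = 3 * s' + 2 * t' + 1 by lia.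
have et : t = 4 * s' + 3 * t' + 1 by lia.
exists s', t'; split; [lia | by move: st; rewrite es et; nia |].
by rewrite es et.
Qed.

Lemma sqtri_root_rank_onto s t : 2 * s ^ 2 = t * t.+1 ->
  exists n, s = sqtri_root n /\ t = sqtri_rank n.
Proof.
elim/ltn_ind: s t => s IHs t st.
have [s0 | s_gt0] := posnP s; first by exists 0; move: st; rewrite s0; case: t.
have [s' [t' [lt_s's st' step]]] := sqtri_step_preim s_gt0 st.
have [n [es' et']] := IHs _ lt_s's _ st'; exists n.+1.
by rewrite sqtri_rootS sqtri_rankS -es' -et'; case: step => -> ->.
Qed.

Lemma odd_sqtri_rank n : odd (sqtri_rank n) = odd n.
Proof. by elim: n => // n IHn; rewrite sqtri_rankS /= -IHn; lia. Qed.

Lemma sqr_eq_div3 u r : u ^ 2 = (r + 2) * (2 * r + 1) ->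
  exists s a, [/\ u = 3 * s, r = 3 * a + 1 & s ^ 2 = (a + 1) * (2 * a + 1)].
Proof.
move=> e.
have [u0 r1] : u %% 3 = 0 /\ r %% 3 = 1.
  have : (u %% 3) ^ 2 = (r %% 3 + 2) * (2 * (r %% 3) + 1) %[mod 3].
    have mod_r2 : r %% 3 + 2 = r + 2 %[mod 3] by rewrite modnDml.
    have mod_2r1 : 2 * (r %% 3) + 1 = 2 * r + 1 %[mod 3].
      by rewrite -modnDml modnMmr modnDml.
    by rewrite modnXm e -modnMm -mod_r2 -mod_2r1 modnMm.
  move: (u %% 3) (r %% 3) (ltn_pmod u (isT : 0 < 3)) (ltn_pmod r (isT : 0 < 3)).
  by move=> [|[|[|//]]] [|[|[|//]]].
have eu : u = 3 * (u %/ 3) by lia.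
have er : r = 3 * (r %/ 3) + 1 by lia.
by exists (u %/ 3), (r %/ 3); split=> //; move: e; rewrite eu er; nia.
Qed.

Lemma neobcE m : neobc m <->
  exists s t, [/\ odd t, 2 * s ^ 2 = t * t.+1 & m = 3 * (s + t./2 + 1)].
Proof.
split=> [[m_gt0 [r [r_gt0 /(neobc_eqE _ m_gt0) e]]] | [s [t [t_odd st ->]]]].
  have [u em] : exists u, m = u + r + 2 by exists (m - (r + 2)); nia.
  have /sqr_eq_div3[s [a [eu er sa]]] : u ^ 2 = (r + 2) * (2 * r + 1).
    by move: e; rewrite em; nia.
  by exists s, (2 * a + 1); split; [lia | nia | lia].
split; first lia.
exists (3 * t./2 + 1); split; first lia.
apply/neobc_eqE; first lia.
have et : t = 2 * t./2 + 1 by lia.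
by move: st; rewrite [in X in X -> _]et; nia.
Qed.

Definition neobc_number (k : nat) : nat :=
  3 * (sqtri_root k.*2.+1 + (sqtri_rank k.*2.+1)./2 + 1).

Lemma neobc_numberP m : neobc m <-> exists k, m = neobc_number k.
Proof.
rewrite neobcE; split=> [[s [t [t_odd st ->]]] | [k ->]].
  have [n [es et]] := sqtri_root_rank_onto st; exists n./2.
  rewrite et odd_sqtri_rank in t_odd.
  by rewrite /neobc_number es et; have -> : n./2.*2.+1 = n by lia.
exists (sqtri_root k.*2.+1), (sqtri_rank k.*2.+1).
by rewrite odd_sqtri_rank /= odd_double sqtri_root_rank.
Qed.

Lemma neobc_number_ltn : {homo neobc_number : j k / j < k}.
Proof.
apply: homo_ltn => [|k]; first exact: ltn_trans.
rewrite /neobc_number doubleS.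
rewrite (sqtri_rootS k.*2.+2) (sqtri_rankS k.*2.+2).
by rewrite (sqtri_rootS k.*2.+1) (sqtri_rankS k.*2.+1); lia.
Qed.

Lemma neobc_nth_enum (f : nat -> nat) :
    {homo f : j k / j < k} -> (forall m, neobc m <-> exists k, m = f k) ->
  forall k, neobc_nth k.+1 = f k.
Proof.
move=> f_incr fP.
have least_above n k : (forall j, (n < f j) = (k <= j)) ->
    ex_minn (neobc_unbounded n) = f k.
  move=> gt_n; case: ex_minnP => m /andP[/neobcP/fP[j ->]].
  rewrite gt_n => le_kj f_min; apply/eqP.
  rewrite eqn_leq [f k <= _](leq_mono f_incr) le_kj andbT; apply: f_min.
  by rewrite gt_n leqnn andbT; apply/neobcP/fP; exists k.
elim=> [|k IHk]; apply: least_above => j; last first.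
  by rewrite -/(neobc_nth k.+1) IHk (leqW_mono (leq_mono f_incr)).
by have [] : neobc (f j) by apply/fP; exists j.
Qed.

Lemma neobc_nthS k : neobc_nth k.+1 = neobc_number k.
Proof. exact: (neobc_nth_enum neobc_number_ltn neobc_numberP). Qed.

Local Open Scope ring_scope.

Lemma exprD1_sqrt2 (K : comNzRingType) (w : K) n : w ^+ 2 = 2 ->
  (1 + w) ^+ (2 * n) = 2 * (sqtri_rank n)%:R + 1 + 2 * (sqtri_root n)%:R * w.
Proof.
move=> w2; elim: n => [|n IHn]; first by rewrite expr0 !(mulr0, mul0r); ring.
have w1 : (1 + w) ^+ 2 = 3 + 2 * w by rewrite sqrrD w2; ring.
rewrite mulnS exprD IHn w1 sqtri_rootS sqtri_rankS !(natrM, natrD).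
set s := (sqtri_root n)%:R; set t := (sqtri_rank n)%:R.
transitivity (3 * (2 * t + 1) + 4 * s * w ^+ 2 + (2 * (2 * t + 1) + 6 * s) * w).
  by ring.
by rewrite w2; ring.
Qed.

Section BinetFormulas.
Variable R : rcfType.

Lemma sqr_sqrt2 : Num.sqrt 2 ^+ 2 = 2 :> R.
Proof. by rewrite sqr_sqrtr ?ler0n. Qed.

Lemma alphaX2 n : alpha R ^+ (2 * n) =
  2 * (sqtri_rank n)%:R + 1 + 2 * (sqtri_root n)%:R * Num.sqrt 2.
Proof. exact: exprD1_sqrt2 sqr_sqrt2. Qed.

Lemma betaX2 n : beta R ^+ (2 * n) =
  2 * (sqtri_rank n)%:R + 1 - 2 * (sqtri_root n)%:R * Num.sqrt 2.
Proof. by rewrite /beta exprD1_sqrt2 ?sqrrN ?sqr_sqrt2 // mulrN. Qed.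

Lemma sqtri_sideE n : sqtri_side R n = (sqtri_root n)%:R.
Proof.
have sqrt2_neq0 : Num.sqrt 2 != 0 :> R by rewrite sqrtr_eq0 -ltNge ltr0n.
by rewrite /sqtri_side alphaX2 betaX2; field.
Qed.

Lemma sqtri_indexE n : sqtri_index R n = (sqtri_rank n)%:R.
Proof. by rewrite /sqtri_index alphaX2 betaX2; field. Qed.

Lemma sqtri_sideS n :
  sqtri_side R n.+1 = 3 * sqtri_side R n + 2 * sqtri_index R n + 1.
Proof. by rewrite !sqtri_sideE sqtri_indexE sqtri_rootS !(natrM, natrD). Qed.

Lemma sqtri_indexS n :
  sqtri_index R n.+1 = 4 * sqtri_side R n + 3 * sqtri_index R n + 1.
Proof. by rewrite !sqtri_indexE sqtri_sideE sqtri_rankS !(natrM, natrD). Qed.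

Lemma sqtri_side_index n :
  2 * sqtri_side R n ^+ 2 = sqtri_index R n * (sqtri_index R n + 1).
Proof.
by rewrite sqtri_sideE sqtri_indexE -natrX natr1 -!natrM sqtri_root_rank.
Qed.

Lemma sqtriE n : sqtri R n = sqtri_side R n ^+ 2.
Proof.
have := sqtri_side_index n; rewrite sqtri_sideE sqtri_indexE.
have -> : sqtri R n =
    ((alpha R ^+ (2 * n)) ^+ 2 + (beta R ^+ (2 * n)) ^+ 2 - 2) / 32.
  by rewrite -!exprM mulnAC.
rewrite alphaX2 betaX2 sqrrD sqrrB !exprMn sqr_sqrt2; lra.
Qed.

Lemma BnbS k : Bnb R k.+1 =
  3 * (2 * sqtri_side R k.*2.+1 + sqtri_index R k.*2.+1 + 1) / 2.
Proof.
have rank_odd : sqtri_rank k.*2.+1 = (1 + (sqtri_rank k.*2.+1)./2 * 2)%N.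
  by rewrite -[LHS]odd_double_half odd_sqtri_rank /= odd_double muln2.
rewrite /Bnb neobc_nthS sqtri_sideE sqtri_indexE rank_odd /neobc_number.
by rewrite natrM !natrD natrM; field.
Qed.

Lemma CnbS k : Cnb R k.+1 =
  3 * (2 * sqtri_side R k.*2.+1 + 2 * sqtri_index R k.*2.+1 + 1).
Proof.
rewrite /Cnb BnbS; have := sqtri_side_index k.*2.+1.
set s := sqtri_side R _; set t := sqtri_index R _ => st.
have c_ge0 : 0 <= 3 * (2 * s + 2 * t + 1).
  by rewrite /s /t sqtri_sideE sqtri_indexE !(mulr_ge0, addr_ge0).
rewrite -[RHS](ger0_norm c_ge0) -sqrtr_sqr; congr Num.sqrt; lra.
Qed.

End BinetFormulas.

Theorem theorem6p3 (R : rcfType) (n : nat) (hn : (1 <= n)%N) :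
  [/\ sqtri R n = 1 / 36 *
        (if odd n then
           (4 * Bnb R ((n + 1) %/ 2) - Cnb R ((n + 1) %/ 2) - 3) ^+ 2
         else
           (20 * Bnb R ((n + 2) %/ 2) - 7 * Cnb R ((n + 2) %/ 2) - 15) ^+ 2),
      sqtri_side R n = 1 / 6 *
        (if odd n then
           4 * Bnb R ((n + 1) %/ 2) - Cnb R ((n + 1) %/ 2) - 3
         else
           20 * Bnb R ((n + 2) %/ 2) - 7 * Cnb R ((n + 2) %/ 2) - 15)
    & sqtri_index R n = 1 / 12 *
        (if odd n then
           - 8 * Bnb R ((n + 1) %/ 2) + 4 * Cnb R ((n + 1) %/ 2)
         else
           60 * Bnb R ((n + 2) %/ 2) - 4 * Bnb R (n %/ 2)
             - 21 * Cnb R ((n + 2) %/ 2) + Cnb R (n %/ 2) - 48)].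
Proof.
case: (boolP (odd n)) => n_odd.
  have -> : ((n + 1) %/ 2 = n./2.+1)%N by lia.
  have en : (n./2.*2.+1 = n)%N by lia.
  by rewrite sqtriE BnbS CnbS en; split; field.
have [k ek] : exists k, n = k.*2.+2 by exists n./2.-1; lia.
have -> : ((n + 2) %/ 2 = k.+2)%N by lia.
have -> : (n %/ 2 = k.+1)%N by lia.
rewrite sqtriE !BnbS !CnbS doubleS -ek sqtri_sideS sqtri_indexS ek.
by rewrite (sqtri_sideS _ k.*2.+1) (sqtri_indexS _ k.*2.+1); split; field.
Qed.
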